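(* The CNN, the saturated Elman RNN (s-RNN), and the saturated GRU (s-GRU) are rationally recurrent: every function $\Sigma^*\to\mathbb{Q}^k$ computed by a CNN, an s-RNN, or an s-GRU over a finite alphabet $\Sigma$ is a rational series.
   Context: WFA: A weighted finite automaton (WFA) $A$ over a finite alphabet $\Sigma$ consists of a finite state set $Q$ and functions $\lambda : Q \to \mathbb{Q}$ (initial weights), $\tau : Q\times\Sigma\times Q \to \mathbb{Q}$ (transition weights), $\rho : Q \to \mathbb{Q}$ (final weights). A path $\pi = q_0 \to_{x_1} q_1 \to_{x_2}\cdots\to_{x_t} q_t$ has score $A[\pi] = \lambda(q_0)\left(\prod_{i=1}^t \tau(q_{i-1},x_i,q_i)\right)\rho(q_t)$, and $A[x] = \sum_\pi A[\pi]$, summed over all paths producing $x$. A function $\mathbf{f} : \Sigma^* \to \mathbb{Q}^k$ is a rational series if there are WFAs $A_1,\dots,A_k$ with $A_i[x] = f_i(x)$ for all $x\in\Sigma^*$ and $1\le i\le k$. All networks below use an embedding $\Sigma\to\mathbb{Q}^{d_x}$, $x_t\mapsto\mathbf x_t$, rational parameters, and rational biases (suppressed in notation, allowed in every affine map); the initial state is $\mathbf h_0=\mathbf 0$, and the function computed is $x\mapsto\mathbf h_{|x|}$. Elman RNN: $\mathbf h_t=\tanh(\mathbf W\mathbf x_t+\mathbf U\mathbf h_{t-1})$. GRU: $\mathbf z_t=\sigma(\mathbf W^z\mathbf x_t+\mathbf U^z\mathbf h_{t-1})$, $\mathbf r_t=\sigma(\mathbf W^r\mathbf x_t+\mathbf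 U^r\mathbf h_{t-1})$, $\mathbf u_t=\tanh(\mathbf W^u\mathbf x_t+\mathbf U^u(\mathbf r_t\odot\mathbf h_{t-1}))$, $\mathbf h_t=\mathbf z_t\odot\mathbf h_{t-1}+(1-\mathbf z_t)\odot\mathbf u_t$. CNN: a convolutional encoder of some fixed window length $w$; its ($\mathbb{Q}^k$-valued) output $\mathbf h_t$ at time $t$ is a fixed function (convolution followed by an activation) of the embeddings of the last $w$ tokens $x_{t-w+1},\dots,x_t$ (with padding at the beginning of the string). Saturation: the saturated network (prefix ''s-'') is the network in which all squashing functions are replaced by step functions taking their extreme values: $\sigma$ is replaced by the function equal to $1$ on positive and $0$ on negative arguments, and $\tanh$ by the sign function with values in $\{-1,0,1\}$. Parameters of a saturated network are such that no argument of a $\sigma$ is exactly $0$ on any input, so all gates take values in $\{0,1\}$. *)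

(* Defs.v *)
From HB Require Import structures.
From mathcomp Require Import all_boot all_order all_algebra.

Set Implicit Arguments.
Unset Strict Implicit.
Unset Printing Implicit Defensive.

Import Order.TTheory GRing.Theory Num.Theory.
Local Open Scope ring_scope.

Record wfa (S : finType) := Wfa {
  wfa_state : finType;
  wfa_init : wfa_state -> rat;
  wfa_trans : wfa_state -> S -> wfa_state -> rat;
  wfa_final : wfa_state -> rat
}.

(* A path producing x is given by its states q 0, ..., q |x|; the i-th factor
   of the product is the weight of the step q i -> q i.+1 reading the letter
   of x at (0-based) position i. *)
Definition path_score (S : finType) (A : wfa S) (x : seq S)
    (q : {ffun 'I_(size x).+1 -> wfa_state A}) : rat :=
  wfa_init (q ord0) *
  (\prod_(i < size x)
     wfa_trans (q (widen_ord (leqnSn (size x)) i)) (tnth (in_tuple x) i)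
               (q (lift ord0 i))) *
  wfa_final (q ord_max).

Definition wfa_weight (S : finType) (A : wfa S) (x : seq S) : rat :=
  \sum_(q : {ffun 'I_(size x).+1 -> wfa_state A}) path_score q.

Definition rational_series (S : finType) (k : nat)
    (f : seq S -> 'cV[rat]_k) : Prop :=
  exists A : 'I_k -> wfa S, forall (x : seq S) (i : 'I_k),
    wfa_weight (A i) x = f x i 0.

(* An architecture is identified with the class of functions it computes. *)
Definition architecture : Type :=
  forall (S : finType) (k : nat), (seq S -> 'cV[rat]_k) -> Prop.

Definition rationally_recurrent (C : architecture) : Prop :=
  forall (S : finType) (k : nat) (f : seq S -> 'cV[rat]_k),
    C S k f -> rational_series f.

(* The activation is an arbitrary fixed function; entrywise activations are
   the case cnn_act = map_mx phi. The padding vector is also arbitrary. *)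
Record cnn (S : finType) (k : nat) := Cnn {
  cnn_dim : nat;
  cnn_emb : S -> 'cV[rat]_cnn_dim;
  cnn_pad : 'cV[rat]_cnn_dim;
  cnn_width : nat;
  cnn_kernel : 'I_cnn_width -> 'M[rat]_(k, cnn_dim);
  cnn_bias : 'cV[rat]_k;
  cnn_act : 'cV[rat]_k -> 'cV[rat]_k
}.

(* With w the width and t = |x|, the entries of index t, ..., t + w - 1 of the
   string padded on the left by w copies of the padding vector are the
   embeddings of the last w tokens x_{t-w+1}, ..., x_t. *)
Definition cnn_window (S : finType) (k : nat) (N : cnn S k) (x : seq S)
    (j : 'I_(cnn_width N)) : 'cV[rat]_(cnn_dim N) :=
  nth (cnn_pad N)
      (nseq (cnn_width N) (cnn_pad N) ++ [seq cnn_emb N a | a <- x])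
      (size x + j)%N.

(* The empty string is sent to the common initial state h_0 = 0. *)
Definition cnn_out (S : finType) (k : nat) (N : cnn S k) (x : seq S) :
    'cV[rat]_k :=
  if x is [::] then 0 else
  cnn_act N
    (\sum_(j < cnn_width N) cnn_kernel j *m cnn_window x j + cnn_bias N).

Definition cnn_computable : architecture := fun S k f =>
  exists N : cnn S k, forall x : seq S, f x = cnn_out N x.

Record srnn (S : finType) (k : nat) := Srnn {
  srnn_dim : nat;
  srnn_emb : S -> 'cV[rat]_srnn_dim;
  srnn_W : 'M[rat]_(k, srnn_dim);
  srnn_U : 'M[rat]_k;
  srnn_b : 'cV[rat]_k
}.

Definition srnn_step (S : finType) (k : nat) (N : srnn S k)
    (h : 'cV[rat]_k) (a : S) : 'cV[rat]_k :=
  map_mx Num.sg (srnn_W N *m srnn_emb N a + srnn_U N *m h + srnn_b N).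

Definition srnn_out (S : finType) (k : nat) (N : srnn S k) (x : seq S) :
    'cV[rat]_k :=
  foldl (srnn_step N) 0 x.

Definition srnn_computable : architecture := fun S k f =>
  exists N : srnn S k, forall x : seq S, f x = srnn_out N x.

(* Saturated sigmoid. The value at 0 is immaterial: see sgru_saturated. *)
Definition sat_sigma (x : rat) : rat := if 0 < x then 1 else 0.

Definition hadamard (k : nat) (u v : 'cV[rat]_k) : 'cV[rat]_k :=
  \col_i (u i 0 * v i 0).

Record sgru (S : finType) (k : nat) := Sgru {
  sgru_dim : nat;
  sgru_emb : S -> 'cV[rat]_sgru_dim;
  sgru_Wz : 'M[rat]_(k, sgru_dim);
  sgru_Uz : 'M[rat]_k;
  sgru_bz : 'cV[rat]_k;
  sgru_Wr : 'M[rat]_(k, sgru_dim);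
  sgru_Ur : 'M[rat]_k;
  sgru_br : 'cV[rat]_k;
  sgru_Wu : 'M[rat]_(k, sgru_dim);
  sgru_Uu : 'M[rat]_k;
  sgru_bu : 'cV[rat]_k
}.

Definition sgru_zarg (S : finType) (k : nat) (N : sgru S k)
    (h : 'cV[rat]_k) (a : S) : 'cV[rat]_k :=
  sgru_Wz N *m sgru_emb N a + sgru_Uz N *m h + sgru_bz N.

Definition sgru_rarg (S : finType) (k : nat) (N : sgru S k)
    (h : 'cV[rat]_k) (a : S) : 'cV[rat]_k :=
  sgru_Wr N *m sgru_emb N a + sgru_Ur N *m h + sgru_br N.

Definition sgru_step (S : finType) (k : nat) (N : sgru S k)
    (h : 'cV[rat]_k) (a : S) : 'cV[rat]_k :=
  let z := map_mx sat_sigma (sgru_zarg N h a) in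
  let r := map_mx sat_sigma (sgru_rarg N h a) in
  let u := map_mx Num.sg (sgru_Wu N *m sgru_emb N a
                          + sgru_Uu N *m hadamard r h + sgru_bu N) in
  hadamard z h + hadamard (const_mx 1 - z) u.

Definition sgru_out (S : finType) (k : nat) (N : sgru S k) (x : seq S) :
    'cV[rat]_k :=
  foldl (sgru_step N) 0 x.

(* No gate ever receives the argument 0: after any string x, whatever letter a
   comes next. *)
Definition sgru_saturated (S : finType) (k : nat) (N : sgru S k) : Prop :=
  forall (x : seq S) (a : S) (i : 'I_k),
    sgru_zarg N (sgru_out N x) a i 0 != 0 /\
    sgru_rarg N (sgru_out N x) a i 0 != 0.

Definition sgru_computable : architecture := fun S k f =>
  exists N : sgru S k,
    sgru_saturated N /\ forall x : seq S, f x = sgru_out N x.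

(* Main.v *)
(* In all three architectures the hidden state ranges over a finite set: the
   last w tokens for a CNN, vectors over {-1, 0, 1} for the saturated recurrent
   networks. The output is therefore a function of the state of a deterministic
   finite automaton, and such an automaton is a WFA with 0/1 weights in which
   the run is the only path of nonzero score. *)
Require Import Defs.
From mathcomp Require Import all_boot all_order all_algebra.

Set Implicit Arguments.
Unset Strict Implicit.
Unset Printing Implicit Defensive.

Import Order.TTheory GRing.Theory Num.Theory.
Local Open Scope ring_scope.

Section DeterministicAutomata.
Variables (S Q : finType) (q0 : Q) (delta : Q -> S -> Q).

Definition dfa_wfa (out : Q -> rat) : wfa S :=
  @Wfa S Q (fun q => (q == q0)%:R) (fun p a q => (q == delta p a)%:R) out.

Lemma dfa_wfa_weight (out : Q -> rat) (x : seq S) :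
  wfa_weight (dfa_wfa out) x = out (foldl delta q0 x).
Proof.
pose run : {ffun 'I_(size x).+1 -> Q} := 
    [ffun i : 'I_(size x).+1 => foldl delta q0 (take i x)].
have takeS (i : 'I_(size x)) :
    take i.+1 x = rcons (take i x) (tnth (in_tuple x) i).
  by rewrite (tnth_nth (tnth (in_tuple x) i)) -take_nth.
rewrite /wfa_weight (bigD1 run) //= big1 ?addr0.
  rewrite /path_score /= !ffunE take0 eqxx mul1r take_size big1 ?mul1r // => i _.
  by rewrite !ffunE lift0 takeS foldl_rcons eqxx.
(* By contraposition: a nonzero score makes every factor nonzero, so [q] starts in [q0] and each
   step follows [delta]. Induction on the position then gives [q = run]. *)
move=> q; apply: contraNeq; rewrite /path_score /= !mulf_eq0 !negb_or.
case/andP=> /andP[q_init /prodf_neq0 q_step] _.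
apply/eqP/ffunP; case; elim=> [|n IHn] n_lt; rewrite ffunE /=.
  move: q_init; rewrite pnatr_eq0 eqb0 negbK => /eqP <-.
  by rewrite take0; congr (q _); apply: val_inj.
have := q_step (Ordinal (n_lt : (n < size x)%N)) isT.
rewrite pnatr_eq0 eqb0 negbK => /eqP q_next.
rewrite (takeS (Ordinal (n_lt : (n < size x)%N))) foldl_rcons.
have := IHn (ltnW n_lt); rewrite ffunE /= => <-.
transitivity (q (lift ord0 (Ordinal (n_lt : (n < size x)%N)))).
  by congr (q _); apply: val_inj.
by rewrite q_next; congr (delta (q _) _); apply: val_inj.
Qed.

(** One automaton per coordinate; they differ only in their final weights. *)
Lemma dfa_rational_series (k : nat) (out : Q -> 'cV[rat]_k)
    (f : seq S -> 'cV[rat]_k) :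
  (forall x, f x = out (foldl delta q0 x)) -> rational_series f.
Proof.
move=> fE; exists (fun i => dfa_wfa (fun q => out q i 0)) => x i.
by rewrite dfa_wfa_weight fE.
Qed.

End DeterministicAutomata.

Lemma cnn_rationally_recurrent : rationally_recurrent cnn_computable.
Proof.
move=> S k f [N fE]; pose w := cnn_width N.
(* One more token than the window, so that the empty string is the only one
   whose state ends with None. *)
pose Q : finType := w.+1.-tuple (option S).
pose q0 : Q := [tuple None | _ < w.+1].
pose delta (q : Q) (a : S) : Q := [tuple of behead (rcons q (Some a))].
(* [None] decodes to padding, and the index [j.+1] skips the oldest cell, which lies outside the
   window. *)
pose out (q : Q) : 'cV[rat]_k :=
  if last None q is None then 0 else
  cnn_act N
    (\sum_(j < w) cnn_kernel j *m
       oapp (cnn_emb N) (cnn_pad N) (nth None q j.+1) + cnn_bias N).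
have stateE x : foldl delta q0 x =
    drop (size x) (nseq w.+1 None ++ [seq Some a | a <- x]) :> seq _.
  elim/last_ind: x => [|x a IHx].
    rewrite cats0 drop0; apply: (@eq_from_nth _ None).
      by rewrite size_tuple size_nseq.
    move=> i; rewrite size_tuple => i_lt.
    by rewrite -[i]/(val (Ordinal i_lt)) -tnth_nth tnth_mktuple nth_nseq if_same.
  rewrite foldl_rcons /= IHx size_rcons map_rcons -rcons_cat.
  rewrite -drop_rcons ?size_cat ?size_map ?leq_addl //.
  by rewrite -drop1 drop_drop add1n.
apply: (dfa_rational_series (q0 := q0) (delta := delta) (out := out)) => x.
rewrite fE /out stateE.
have -> : last None (drop (size x) (nseq w.+1 None ++ [seq Some a | a <- x]))
          = last None [seq Some a | a <- x].
  case/lastP: x {fE} => [|x a]; first by rewrite cats0 drop0 /=; elim: (w).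
  rewrite map_rcons -rcons_cat drop_rcons ?last_rcons //.
  by rewrite size_rcons size_cat size_map size_nseq addSn ltnS leq_addl.
case/lastP: x => [//|x a]; rewrite [in RHS]map_rcons last_rcons.
rewrite /cnn_out; case def_y: (rcons x a) => [|b y]; first by case: (x) def_y.
rewrite -def_y; congr (cnn_act N (_ + _)); apply: eq_bigr => j _.
(* The extra leading [None] cancels the shift in [j.+1]: both sides now read position [size + j]
   behind [w] padding cells. *)
congr (_ *m _); rewrite /cnn_window -map_rcons nth_drop addnS /=.
set y' := rcons x a.
rewrite !nth_cat !size_nseq -/w; case: ltnP => _.
  by rewrite !nth_nseq !if_same.
(* Past the end, both lookups default to the padding vector. *)
have [lt_j|le_j] := ltnP (size y' + j - w) (size y').
  by rewrite (nth_map a) // (nth_map a).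
by rewrite !nth_default ?size_map.
Qed.

Section TernaryStates.
Variables (S : finType) (k : nat).

Definition ternary (h : 'cV[rat]_k) : Prop :=
  forall i, h i 0 \in [:: 0; 1; -1].

Lemma ternary_foldl_rational_series
    (step : 'cV[rat]_k -> S -> 'cV[rat]_k) (f : seq S -> 'cV[rat]_k) :
  (forall h a, ternary h -> ternary (step h a)) ->
  (forall x, f x = foldl step 0 x) -> rational_series f.
Proof.
move=> step_ternary fE.
pose Q : finType := {ffun 'I_k -> 'I_3}.
pose dec (q : Q) : 'cV[rat]_k := \col_i [:: 0; 1; -1]`_(q i).
(* An entry off the list has index 3, outside ['I_3], so [dec] inverts [enc] on ternary vectors
   only. *)
pose enc (h : 'cV[rat]_k) : Q :=
  [ffun i => inord (index (h i 0) [:: 0; 1; -1])].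
have decK h : ternary h -> dec (enc h) = h.
  move=> ht; apply/colP=> i; rewrite !mxE ffunE inordK ?nth_index //.
  by have := ht i; rewrite -index_mem.
have dec_ternary q : ternary (dec q).
  by move=> i; rewrite mxE mem_nth ?ltn_ord.
have zero_ternary : ternary 0 by move=> i; rewrite mxE mem_head.
apply: (dfa_rational_series (q0 := enc 0)
  (delta := fun q a => enc (step (dec q) a)) (out := dec)) => x.
rewrite fE; elim/last_ind: x => [|x a IHx]; first by rewrite /= decK.
by rewrite !foldl_rcons IHx decK //; apply: step_ternary; apply: dec_ternary.
Qed.

End TernaryStates.

Lemma sgr_ternary (x : rat) : Num.sg x \in [:: 0; 1; -1].
Proof. by case: sgrP. Qed.

Lemma srnn_rationally_recurrent : rationally_recurrent srnn_computable.
Proof.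
move=> S k f [N fE]; apply: ternary_foldl_rational_series fE => h a _ i.
by rewrite mxE sgr_ternary.
Qed.

(** A 0/1 update gate either keeps the old coordinate, ternary by induction, or overwrites it with a
    sign. *)
Lemma sgru_rationally_recurrent : rationally_recurrent sgru_computable.
Proof.
move=> S k f [N [_ fE]]; apply: ternary_foldl_rational_series fE => h a ht i.
rewrite /sgru_step /hadamard; set u := map_mx Num.sg _.
have ut : u i 0 \in [:: 0; 1; -1] by rewrite mxE sgr_ternary.
(* Forgetting the body of [u] keeps [mxE] from expanding it. *)
move: u ut => u ut; rewrite !mxE /sat_sigma; case: ifP => _.
  by rewrite subrr mul1r mul0r addr0.
by rewrite subr0 mul1r mul0r add0r.
Qed.

Theorem theorem5 :
  rationally_recurrent cnn_computable /\
  rationally_recurrent srnn_computable /\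
  rationally_recurrent sgru_computable.
Proof.
split; first exact: cnn_rationally_recurrent.
split; [exact: srnn_rationally_recurrent | exact: sgru_rationally_recurrent].
Qed.
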